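(* Let $C,h,f,\Psi$ satisfy the standing assumption, let $F=f+\Psi$, let $f$ be $L$-smooth relative to $h$ on $C$ with $L>0$, and let $\gamma=\gamma_{\mathrm{in}}>1$ be the intrinsic triangle scaling exponent of $D_h$. Let $x_0\in\operatorname{rint}C$, $\rho>1$, $G_{\min}>0$, and let the sequences $\{x_k\},\{y_k\},\{z_k\},\{\theta_k\},\{G_k\}$ be generated by the ABPG-g method (described in the context). Then for any $x\in C\cap\operatorname{dom}h$, $$F(x_{k+1})-F(x)\le\left(\frac{\gamma}{k+\gamma}\right)^{\gamma}\overline{G}_k\,L\,D_h(x,x_0),\qquad\forall\,k\ge0,$$ where $\overline{G}_k=\left(G_0^{\gamma}G_1\cdots G_k\right)^{\frac1{k+\gamma}}$.
   Context: Standing assumption: $C\subset\mathbb{R}^n$ is a closed convex set and $h:\mathbb{R}^n\to(-\infty,+\infty]$ is strictly convex and differentiable on an open set containing $\operatorname{rint}C$ ($\operatorname{rint}$ = relative interior). Moreover: (1) $h$ is of Legendre type, i.e. essentially smooth and strictly convex in $\operatorname{rint}\operatorname{dom}h$, where essentially smooth means that it is differentiable and $\|\nabla h(x_k)\|\to\infty$ for every sequence $\{x_k\}$ converging to a boundary point of $\operatorname{dom}h$; (2) $f:\mathbb{R}^n\to(-\infty,\infty]$ is proper, closed, convex, and differentiable on an open set containing $\operatorname{rint}C$; (3) $\Psi:\mathbb{R}^n\to(-\infty,\infty]$ is proper, closed, convex, with $\operatorname{dom}\Psi\cap\operatorname{rint}\operatorname{dom}h\ne\emptyset$; (4) $\inf_{x\in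 C}\{f(x)+\Psi(x)\}>-\infty$; (5) the steps of the algorithm are well posed: each minimizer $z_{k+1}$ exists, is unique, and belongs to $\operatorname{rint}C$, and the inner search over $t$ terminates at every iteration. Bregman distance: $D_h(x,y)=h(x)-h(y)-\langle\nabla h(y),x-y\rangle$ for $x\in\operatorname{dom}h$, $y\in\operatorname{rint}\operatorname{dom}h$. Relative smoothness: $f$ is $L$-smooth relative to $h$ on $C$ if $L>0$ and $f(x)\le f(y)+\langle\nabla f(y),x-y\rangle+L\,D_h(x,y)$ for all $x\in C$, $y\in\operatorname{rint}C$. Intrinsic triangle scaling exponent: $\gamma_{\mathrm{in}}$ is the largest $\gamma$ such that for all $x,z,\tilde z\in\operatorname{rint}\operatorname{dom}h$, $\limsup_{\theta\to0^+}\theta^{-\gamma}D_h((1-\theta)x+\theta z,(1-\theta)x+\theta\tilde z)<\infty$. Linearization: $\ell(x|y)=f(y)+\langle\nabla f(y),x-y\rangle+\Psi(x)$. ABPG-g method (ABPG with gain adaptation): set $z_0=x_0$, $\theta_0=1$, $G_{-1}=1$. For $k=0,1,2,\dots$: set $M_k=\max\{G_{k-1}/\rho,G_{\min}\}$. For $t=0,1,2,\dots$ compute $G_k=M_k\rho^t$; if $k>0$, $\theta_k\in(0,1]$ as the solution of $\frac{1-\theta_k}{G_k\theta_k^\gamma}=\frac1{G_{k-1}\theta_{k-1}^\gamma}$; $y_k=(1-\theta_k)x_k+\theta_kz_k$; $z_{k+1}=\operatorname{arg\,min}_{z\in C}\{\ell(z|y_k)+G_k\theta_k^{\gamma-1}L\,D_h(z,z_k)\}$;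 $x_{k+1}=(1-\theta_k)x_k+\theta_kz_{k+1}$; stopping at the first $t$ for which $f(x_{k+1})\le f(y_k)+\langle\nabla f(y_k),x_{k+1}-y_k\rangle+G_k\theta_k^\gamma L\,D_h(z_{k+1},z_k)$, and keeping the resulting $G_k,\theta_k,y_k,z_{k+1},x_{k+1}$. If $F(x)=+\infty$, the inequality is understood to hold trivially. *)

(* Defs.v *)
From HB Require Import structures.
From mathcomp Require Import all_boot all_order all_algebra.
From mathcomp Require Import all_classical all_reals all_analysis.

Set Implicit Arguments.
Unset Strict Implicit.
Unset Printing Implicit Defensive.

Import Order.TTheory GRing.Theory Num.Theory.
Import numFieldNormedType.Exports.

Local Open Scope classical_set_scope.
Local Open Scope ring_scope.

(* MathComp-Analysis; R^n is 'rV[R]_n. Its library norm is the sup norm, which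
   gives the usual topology and differentiability; inner products and gradient
   norms are the Euclidean ones below. *)

Definition dot (R : realType) (n : nat) (u v : 'rV[R]_n) : R :=
  \sum_(i < n) u 0 i * v 0 i.

Definition enorm (R : realType) (n : nat) (u : 'rV[R]_n) : R :=
  Num.sqrt (dot u u).

Definition affine_set (R : realType) (n : nat) (A : set 'rV[R]_n) : Prop :=
  forall (x y : 'rV[R]_n) (s : R), A x -> A y -> A ((1 - s) *: x + s *: y).

Definition affine_hull (R : realType) (n : nat) (A : set 'rV[R]_n) :
  set 'rV[R]_n := smallest (@affine_set R n) A.

Definition rint (R : realType) (n : nat) (A : set 'rV[R]_n) : set 'rV[R]_n :=
  [set x | A x /\ exists2 V, nbhs x V & V `&` affine_hull A `<=` A].

Definition edom (R : realType) (n : nat) (g : 'rV[R]_n -> \bar R) :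
  set 'rV[R]_n := [set x | (g x < +oo)%E].

Definition proper (R : realType) (n : nat) (g : 'rV[R]_n -> \bar R) : Prop :=
  (forall x, (-oo < g x)%E) /\ edom g !=set0.

Definition econvex (R : realType) (n : nat) (g : 'rV[R]_n -> \bar R) : Prop :=
  forall (x y : 'rV[R]_n) (s : R), 0 < s < 1 ->
    (g ((1 - s) *: x + s *: y)%R <= (1 - s)%:E * g x + s%:E * g y)%E.

Definition strictly_econvex_on (R : realType) (n : nat) (A : set 'rV[R]_n)
    (g : 'rV[R]_n -> \bar R) : Prop :=
  forall (x y : 'rV[R]_n) (s : R), A x -> A y -> x <> y -> 0 < s < 1 ->
    (g ((1 - s) *: x + s *: y)%R < (1 - s)%:E * g x + s%:E * g y)%E.

(* An extended-real function is differentiable at x when it is finite around x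
   and its real-valued part is Frechet differentiable there. *)
Definition edifferentiable (R : realType) (n : nat) (g : 'rV[R]_n -> \bar R)
    (x : 'rV[R]_n) : Prop :=
  (\forall y \near x, g y \is a fin_num) /\ differentiable (fine \o g) x.

Definition grad (R : realType) (n : nat) (g : 'rV[R]_n -> \bar R)
    (x : 'rV[R]_n) : 'rV[R]_n :=
  \row_(i < n) 'D_(delta_mx 0 i) (fine \o g) x.

Definition essentially_smooth (R : realType) (n : nat)
    (h : 'rV[R]_n -> \bar R) : Prop :=
  (forall x, rint (edom h) x -> edifferentiable h x) /\
  (forall (u : nat -> 'rV[R]_n) (b : 'rV[R]_n),
     (forall k, rint (edom h) (u k)) ->
     closure (edom h) b -> ~ interior (edom h) b ->
     u @ \oo --> b ->
     (fun k => enorm (grad h (u k))) @ \oo --> +oo).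

(* A function of Legendre type is in particular convex on the whole space with
   values in (-oo, +oo]. *)
Definition legendre (R : realType) (n : nat) (h : 'rV[R]_n -> \bar R) : Prop :=
  [/\ proper h, econvex h, essentially_smooth h
    & strictly_econvex_on (rint (edom h)) h].

(* Extended-real valued: +oo when x is outside the domain of h. *)
Definition bregman (R : realType) (n : nat) (h : 'rV[R]_n -> \bar R)
    (x y : 'rV[R]_n) : \bar R :=
  (h x - h y - (dot (grad h y) (x - y)%R)%:E)%E.

Definition relatively_smooth (R : realType) (n : nat) (C : set 'rV[R]_n)
    (f h : 'rV[R]_n -> \bar R) (L : R) : Prop :=
  0 < L /\ forall x y : 'rV[R]_n, C x -> rint C y ->
    (f x <= f y + (dot (grad f y) (x - y)%R)%:E + L%:E * bregman h x y)%E.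

Definition triangle_scaling (R : realType) (n : nat) (h : 'rV[R]_n -> \bar R)
    (gamma : R) : Prop :=
  forall x z z' : 'rV[R]_n,
    rint (edom h) x -> rint (edom h) z -> rint (edom h) z' ->
    (limf_esup (fun s : R => (s `^ (- gamma))%:E *
       bregman h ((1 - s) *: x + s *: z)%R ((1 - s) *: x + s *: z')%R)
     0^'+ < +oo)%E.

Definition intrinsic_tse (R : realType) (n : nat) (h : 'rV[R]_n -> \bar R)
    (gamma : R) : Prop :=
  triangle_scaling h gamma /\
  forall gamma' : R, triangle_scaling h gamma' -> gamma' <= gamma.

Definition standing_assumption (R : realType) (n : nat) (C : set 'rV[R]_n)
    (h f Psi : 'rV[R]_n -> \bar R) : Prop :=
  closed C /\ convex_set C /\
  (exists U : set 'rV[R]_n, [/\ open U, rint C `<=` U,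
     forall x, U x -> edifferentiable h x & strictly_econvex_on U h]) /\
  legendre h /\
  [/\ proper f, lower_semicontinuous f, econvex f
    & exists U : set 'rV[R]_n, [/\ open U, rint C `<=` U
        & forall x, U x -> edifferentiable f x]] /\
  [/\ proper Psi, lower_semicontinuous Psi, econvex Psi
    & edom Psi `&` rint (edom h) !=set0] /\
  (-oo < ereal_inf [set (f x + Psi x)%E | x in C])%E.

Definition argmin_on (R : realType) (n : nat) (C : set 'rV[R]_n)
    (phi : 'rV[R]_n -> \bar R) : set 'rV[R]_n :=
  [set z | C z /\ forall w, C w -> (phi z <= phi w)%E].

Definition linearization (R : realType) (n : nat)
    (f Psi : 'rV[R]_n -> \bar R) (x y : 'rV[R]_n) : \bar R :=
  (f y + (dot (grad f y) (x - y)%R)%:E + Psi x)%E.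

Definition subproblem (R : realType) (n : nat) (h f Psi : 'rV[R]_n -> \bar R)
    (L gamma g th : R) (y zk : 'rV[R]_n) : 'rV[R]_n -> \bar R :=
  fun z => (linearization f Psi z y +
            (g * th `^ (gamma - 1) * L)%:E * bregman h z zk)%E.

(* The initial gain M_k, with G_{-1} = 1. *)
Definition gain_start (R : realType) (rho Gmin : R) (G : nat -> R) (k : nat) :
    R :=
  Num.max ((if k is j.+1 then G j else 1) / rho) Gmin.

(* th is the value of theta_k belonging to the trial gain g at iteration k. *)
Definition theta_rule (R : realType) (gamma : R) (G theta : nat -> R)
    (k : nat) (g th : R) : Prop :=
  if k is j.+1 then
    0 < th <= 1 /\
    (1 - th) / (g * th `^ gamma) = 1 / (G j * theta j `^ gamma)
  else th = 1.

Definition accepted (R : realType) (n : nat) (h f : 'rV[R]_n -> \bar R)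
    (L gamma g th : R) (y x1 z1 zk : 'rV[R]_n) : Prop :=
  (f x1 <= f y + (dot (grad f y) (x1 - y)%R)%:E +
           (g * th `^ gamma * L)%:E * bregman h z1 zk)%E.

(* t k is the index at which the inner search of iteration k stops, so that
   termination of every inner search is part of being a run. The trial gain of
   index s is gain_start k * rho ^+ s; the last conjunct says that all trials
   before t k are rejected. *)
Definition abpg_g (R : realType) (n : nat) (C : set 'rV[R]_n)
    (h f Psi : 'rV[R]_n -> \bar R) (L gamma rho Gmin : R) (x0 : 'rV[R]_n)
    (x y z : nat -> 'rV[R]_n) (theta G : nat -> R) (t : nat -> nat) : Prop :=
  x 0%N = x0 /\ z 0%N = x0 /\
  forall k : nat,
    G k = gain_start rho Gmin G k * rho ^+ t k /\
    theta_rule gamma G theta k (G k) (theta k) /\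
    y k = (1 - theta k) *: x k + theta k *: z k /\
    argmin_on C (subproblem h f Psi L gamma (G k) (theta k) (y k) (z k))
      (z k.+1) /\
    x k.+1 = (1 - theta k) *: x k + theta k *: z k.+1 /\
    accepted h f L gamma (G k) (theta k) (y k) (x k.+1) (z k.+1) (z k) /\
    (forall (s : nat) (th : R) (z1 : 'rV[R]_n), (s < t k)%N ->
       let g := gain_start rho Gmin G k * rho ^+ s in
       let yt := (1 - th) *: x k + th *: z k in
       theta_rule gamma G theta k g th ->
       argmin_on C (subproblem h f Psi L gamma g th yt (z k)) z1 ->
       ~ accepted h f L gamma g th yt ((1 - th) *: x k + th *: z1) z1 (z k)).

(* At every trial actually performed, rejected or accepted, the subproblem has
   exactly one minimizer over C, and it lies in rint C. *)
Definition abpg_g_well_posed (R : realType) (n : nat) (C : set 'rV[R]_n)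
    (h f Psi : 'rV[R]_n -> \bar R) (L gamma rho Gmin : R)
    (x z : nat -> 'rV[R]_n) (theta G : nat -> R) (t : nat -> nat) : Prop :=
  forall (k s : nat) (th : R), (s <= t k)%N ->
    let g := gain_start rho Gmin G k * rho ^+ s in
    let yt := (1 - th) *: x k + th *: z k in
    theta_rule gamma G theta k g th ->
    exists2 z1, rint C z1 &
      argmin_on C (subproblem h f Psi L gamma g th yt (z k)) = [set z1].

Definition Gbar (R : realType) (gamma : R) (G : nat -> R) (k : nat) : R :=
  (G 0%N `^ gamma * \prod_(1 <= i < k.+1) G i) `^ (1 / (k%:R + gamma)).

(* Main.v *)
Require Import Defs.
From HB Require Import structures.
From mathcomp Require Import all_boot all_order all_algebra.
From mathcomp Require Import all_classical all_reals all_analysis.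
From mathcomp Require Import ring lra.

Set Implicit Arguments.
Unset Strict Implicit.
Unset Printing Implicit Defensive.

Import Order.TTheory GRing.Theory Num.Theory.
Import numFieldNormedType.Exports.

Local Open Scope classical_set_scope.
Local Open Scope ring_scope.

(** The proof is a Lyapunov argument followed by a growth estimate for the
    scalars theta_k.

    One iteration. Write A_k = G_k theta_k^gamma. The acceptance test bounds
    f (x_{k+1}) by its linearization at y_k plus A_k L D_h(z_{k+1}, z_k). The
    linearization (with Psi added) is convex, and x_{k+1} is the convex
    combination of x_k and z_{k+1} with weight theta_k; at z_{k+1}, the
    minimality in the subproblem gives the three-point inequality
    [bregman_three_point], which trades z_{k+1} for an arbitrary w at the price
    of D_h(w, z_k) - D_h(w, z_{k+1}). Since linearizations minorize F, this
    gives [abpg_step]: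
      F(x_{k+1}) - F(w) + A_k L D_h(w, z_{k+1})
        <= (1 - theta_k) (F(x_k) - F(w)) + A_k L D_h(w, z_k).

    Telescoping. The rule for theta_k says that (1 - theta_k) / A_k = 1 / A_{k-1},
    so dividing by A_k makes the inequalities telescope down to k = 0, where
    theta_0 = 1 removes F(x_0), which may be infinite. Dropping the nonnegative
    D_h(w, z_{k+1}) leaves F(x_{k+1}) - F(w) <= A_k L D_h(w, x_0).

    Growth. With B_k = A_k^(-1/gamma) and a_k = G_k^(1/gamma), the same rule and
    a Bernoulli inequality give B_{k+1} >= B_k + 1 / (gamma a_{k+1}), hence
    gamma B_k >= gamma / a_0 + 1 / a_1 + ... + 1 / a_k. The weighted
    arithmetic-geometric inequality bounds the right-hand side below by the
    geometric mean of the gains, which is [gain_product_bound]. *)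

(** * Weighted geometric means and the growth of the weights *)

(** The weighted arithmetic-geometric inequality in logarithmic form: sum the
    tangent bounds ln u <= u - 1 at the ratios of the b i to their mean; the
    weighted sum of the right-hand sides vanishes. *)
Lemma concave_ln_sum (R : realType) (I : finType) (w b : I -> R) :
  (forall i, 0 <= w i) -> (forall i, 0 < b i) -> 0 < \sum_i w i ->
  \sum_i w i * ln (b i) <= (\sum_i w i) * ln ((\sum_i w i * b i) / \sum_i w i).
Proof.
move=> w0 b0; set W := \sum_i w i => W0.
have [i0 wi0] : exists i, 0 < w i.
  apply/existsP; apply: contraTT W0 => /existsPn wn0.
  by rewrite -leNgt /W; apply: sumr_le0 => i _; rewrite leNgt wn0.
have S0 : 0 < \sum_i w i * b i.
  apply: lt_le_trans (_ : 0 < w i0 * b i0) _; first by rewrite mulr_gt0.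
  rewrite (bigD1 i0)//= lerDl sumr_ge0// => i _.
  by rewrite mulr_ge0// ltW.
set m := _ / W; have m0 : 0 < m by rewrite divr_gt0.
have Wm : \sum_i w i * b i = W * m by rewrite /m mulrC divfK// gt_eqF.
rewrite -subr_le0 /W mulr_suml -sumrB.
apply: le_trans (_ : \sum_i w i * (b i / m - 1) <= _); last first.
  under eq_bigr do rewrite mulrBr mulrA mulr1.
  by rewrite sumrB -mulr_suml Wm mulfK ?gt_eqF// subrr.
apply: ler_sum => i _; rewrite -mulrBr ler_wpM2l// -ln_div ?posrE//.
have := @le_ln1Dx R (b i / m - 1); rewrite (_ : 1 + _ = b i / m); last by ring.
by apply; rewrite ltrBrDl subrr divr_gt0.
Qed.

(** Bernoulli's inequality for an exponent at most 1, as the two-point case of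
    [concave_ln_sum] with values u and 1. *)
Lemma powR_inv_le_tangent (R : realType) (p u : R) : 1 <= p -> 0 < u ->
  u `^ p^-1 <= 1 - (1 - u) / p.
Proof.
move=> p1 u0; have p0 : 0 < p by lra.
have pV1 : p^-1 <= 1 by rewrite invf_le1.
have pV0 : 0 < p^-1 by rewrite invr_gt0.
pose w := fun b : bool => if b then p^-1 else 1 - p^-1.
pose v := fun b : bool => if b then u else 1 : R.
have E : 1 - (1 - u) / p = p^-1 * u + (1 - p^-1) * 1 by ring.
have T0 : 0 < 1 - (1 - u) / p.
  by rewrite E ltr_wpDr ?mulr_ge0 ?mulr_gt0 ?subr_ge0.
have := @concave_ln_sum R bool w v.
rewrite !big_bool /= ln1 mulr0 addr0 (addrC _ (1 - _)) subrK divr1 mul1r -E.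
move=> H; rewrite -ler_ln ?posrE ?powR_gt0// ln_powR; apply: H => //.
- by case; rewrite /w ?subr_ge0// ltW.
- by case.
Qed.

(** Taking gamma-th roots turns the multiplicative recursion for the weights
    into an additive lower bound on their growth, to which the
    arithmetic-geometric inequality applies with weights gamma, 1, ..., 1 on
    the inverse roots of the gains. *)
Lemma gain_product_bound (R : realType) (gamma : R) (G theta : nat -> R) :
  1 < gamma -> (forall k, 0 < G k) -> (forall k, 0 < theta k <= 1) ->
  theta 0%N = 1 ->
  (forall k, (1 - theta k.+1) / (G k.+1 * theta k.+1 `^ gamma) =
             1 / (G k * theta k `^ gamma)) ->
  forall k, G k * theta k `^ gamma <=
            (gamma / (k%:R + gamma)) `^ gamma * Gbar gamma G k.
Proof.
move=> g1 G0 th01 th0 rec k.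
have g0 : 0 < gamma by lra.
have gN : gamma != 0 by rewrite gt_eqF.
have thp i : 0 < theta i by have /andP[] := th01 i.
pose a i := G i `^ gamma^-1.
have a0 i : 0 < a i by rewrite powR_gt0.
have aG i : a i `^ gamma = G i by rewrite -powRrM mulVf// powRr1// ltW.
pose B i := (a i * theta i)^-1.
have B0 i : 0 < B i by rewrite invr_gt0 mulr_gt0.
have BE i : B i `^ gamma = (G i * theta i `^ gamma)^-1.
  have -> : B i = (a i * theta i) `^ (-1) by rewrite powR_inv1// mulr_ge0// ltW.
  rewrite -powRrM (mulrC (-1)) powRrM powRM ?(ltW (a0 _)) ?(ltW (thp _))// aG.
  by rewrite powR_inv1// mulr_ge0 ?powR_ge0// ltW.
have step i : B i + (gamma * a i.+1)^-1 <= B i.+1.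
  have Hrec := rec i.
  have dp j : 0 < G j * theta j `^ gamma by rewrite mulr_gt0 ?powR_gt0.
  have u0 : 0 < 1 - theta i.+1.
    rewrite -(pmulr_lgt0 _ (_ : 0 < (G i.+1 * theta i.+1 `^ gamma)^-1)) ?invr_gt0//.
    by rewrite Hrec divr_gt0.
  have -> : B i = (1 - theta i.+1) `^ gamma^-1 * B i.+1.
    apply: (@powR_injective R gamma) => //; rewrite ?nnegrE ?mulr_ge0 ?powR_ge0 ?(ltW (B0 _))//.
    rewrite powRM ?powR_ge0 ?(ltW (B0 _))// -powRrM mulVf// powRr1 ?(ltW u0)//.
    by rewrite !BE Hrec mul1r.
  have T := @powR_inv_le_tangent R gamma _ (ltW g1) u0.
  have -> : (gamma * a i.+1)^-1 = theta i.+1 / gamma * B i.+1.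
    by rewrite /B; field; rewrite gN !gt_eqF.
  rewrite -mulrDl ler_piMl ?(ltW (B0 _))//.
  by move: T; rewrite (_ : 1 - (1 - theta i.+1) = theta i.+1); [lra|ring].
have sumB : gamma / a 0%N + \sum_(i < k) (a i.+1)^-1 <= gamma * B k.
  elim: k => [|k IH].
    by rewrite big_ord0 addr0 /B th0 mulr1.
  rewrite big_ord_recr /= addrA.
  apply: le_trans (lerD IH (lexx _)) _.
  apply: le_trans (ler_wpM2l (ltW g0) (step k)).
  by rewrite mulrDr lerD2l invfM mulrA mulfV// mul1r.
have kg0 : 0 < k%:R + gamma by rewrite ltr_wpDl.
pose w (i : 'I_k.+1) := if (i == 0%N :> nat) then gamma else 1.
have sw : \sum_i w i = k%:R + gamma.
  by rewrite big_ord_recl /= addrC /w/= sumr_const card_ord.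
have := @concave_ln_sum R 'I_k.+1 w (fun i => (a i)^-1).
rewrite sw !big_ord_recl /= {1 3}/w /= => H.
have {H} : gamma * ln (a 0%N)^-1 + \sum_(i < k) ln (a i.+1)^-1 <=
    (k%:R + gamma) * ln ((gamma * B k) / (k%:R + gamma)).
  under eq_bigr do rewrite -[ln _]mul1r.
  apply: le_trans (H _ _ kg0) _.
  - by move=> i; rewrite /w; case: ifP => // _; rewrite ltW.
  - by move=> i; rewrite invr_gt0.
  under eq_bigr do rewrite /w /= mul1r.
  rewrite ler_pM2l// ler_ln ?posrE ?divr_gt0 ?mulr_gt0//.
    by rewrite ler_pM2r ?invr_gt0.
  rewrite ltr_wpDr ?divr_gt0//; apply: sumr_ge0 => i _.
  by rewrite invr_ge0 ltW.
move=> H.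
have P0 : 0 < \prod_(1 <= i < k.+1) G i by apply: prodr_gt0.
have lnP : ln (\prod_(1 <= i < k.+1) G i) = \sum_(i < k) gamma * ln (a i.+1).
  rewrite big_add1 /= big_mkord.
  have -> : \prod_(i < k) G i.+1 = expR (\sum_(i < k) gamma * ln (a i.+1)).
    rewrite expR_sum; apply: eq_bigr => i _.
    by rewrite -ln_powR aG lnK// posrE.
  by rewrite expRK.
rewrite -[G k * _]invrK -BE -ler_ln ?posrE; last 2 first.
- by rewrite invr_gt0 powR_gt0.
- by rewrite mulr_gt0 ?powR_gt0 ?divr_gt0// mulr_gt0 ?powR_gt0.
rewrite lnV ?posrE ?powR_gt0// lnM ?posrE ?powR_gt0 ?divr_gt0//; last first.
  by rewrite mulr_gt0 ?powR_gt0.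
rewrite /Gbar !ln_powR ln_div ?posrE// lnM ?posrE ?powR_gt0// lnP ln_powR -(aG 0%N) ln_powR.
have := H; rewrite ln_div ?posrE ?mulr_gt0// lnM ?posrE// -mulr_sumr lnV ?posrE//.
under eq_bigr do rewrite lnV ?posrE//.
rewrite sumrN => H'.
rewrite -(ler_pM2l kg0).
have -> : (k%:R + gamma) * (gamma * (ln gamma - ln (k%:R + gamma)) +
  1 / (k%:R + gamma) * (gamma * (gamma * ln (a 0%N)) +
  gamma * \sum_(i < k) ln (a i.+1))) = gamma * ((k%:R + gamma) * (ln gamma - ln (k%:R + gamma)) + gamma * ln (a 0%N) + \sum_(i < k) ln (a i.+1)).
  by field; rewrite gt_eqF.
rewrite -mulrN mulrCA ler_pM2l//; lra.
Qed.

(** * Gradients, relative interiors and extended-real convexity *)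

Lemma dotDr (R : realType) (n : nat) (u v w : 'rV[R]_n) :
  dot u (v + w) = dot u v + dot u w.
Proof. by rewrite /dot -big_split; apply: eq_bigr => i _; rewrite mxE mulrDr. Qed.

Lemma dotZr (R : realType) (n : nat) (u v : 'rV[R]_n) (s : R) :
  dot u (s *: v) = s * dot u v.
Proof. by rewrite /dot mulr_sumr; apply: eq_bigr => i _; rewrite mxE mulrCA. Qed.

Lemma dotBr (R : realType) (n : nat) (u v w : 'rV[R]_n) :
  dot u (v - w) = dot u v - dot u w.
Proof. by rewrite dotDr -scaleN1r dotZr mulN1r. Qed.

Lemma dot_gradE (R : realType) (n : nat) (g : 'rV[R]_n -> \bar R)
    (x v : 'rV[R]_n) :
  differentiable (fine \o g) x -> dot (grad g x) v = 'D_v (fine \o g) x.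
Proof.
move=> dg; rewrite deriveE// [in RHS](row_sum_delta v) linear_sum.
by apply: eq_bigr => i _; rewrite mxE deriveE// linearZ /= mulrC.
Qed.

(** A bound on the difference quotients over ]0, 1[ passes to the directional
    derivative, because a two-sided limit is also the limit from the right. *)
Lemma dot_grad_le (R : realType) (n : nat) (g : 'rV[R]_n -> \bar R)
    (x v : 'rV[R]_n) (K : R) :
  differentiable (fine \o g) x ->
  (forall s, 0 < s < 1 -> fine (g (x + s *: v)) - fine (g x) <= s * K) ->
  dot (grad g x) v <= K.
Proof.
move=> dg H; rewrite dot_gradE// /derive.
have dv : derivable (fine \o g) x v by exact: diff_derivable.
rewrite cvg_at_rightE//; apply: limr_le.
  by apply/cvg_ex; exists ('D_v (fine \o g) x); exact: cvg_dnbhs_at_right dv.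
near=> s; have s0 : 0 < s by [].
rewrite /= [s *: v + x]addrC -ler_pdivlMl ?invr_gt0// invrK.
by apply: H; rewrite s0/=; near: s; exact: nbhs_right_lt.
Unshelve. all: by end_near. Qed.

Lemma dot_grad_ge (R : realType) (n : nat) (g : 'rV[R]_n -> \bar R)
    (x v : 'rV[R]_n) (K : R) :
  differentiable (fine \o g) x ->
  (forall s, 0 < s < 1 -> s * K <= fine (g (x + s *: v)) - fine (g x)) ->
  K <= dot (grad g x) v.
Proof.
move=> dg H; rewrite dot_gradE// /derive.
have dv : derivable (fine \o g) x v by exact: diff_derivable.
rewrite cvg_at_rightE//; apply: limr_ge.
  by apply/cvg_ex; exists ('D_v (fine \o g) x); exact: cvg_dnbhs_at_right dv.
near=> s; have s0 : 0 < s by [].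
rewrite /= [s *: v + x]addrC -ler_pdivrMl ?invr_gt0// invrK.
by apply: H; rewrite s0/=; near: s; exact: nbhs_right_lt.
Unshelve. all: by end_near. Qed.

Lemma convex_set_comb (R : realType) (n : nat) (C : set 'rV[R]_n) (x y : 'rV[R]_n)
    (s : R) :
  convex_set C -> C x -> C y -> 0 <= s <= 1 -> C ((1 - s) *: x + s *: y).
Proof.
move=> cC Cx Cy /andP[s0 s1].
have s0' : 0 <= 1 - s by rewrite subr_ge0.
have s1' : 1 - s <= 1 by rewrite lerBlDr lerDl.
have := cC x y (Itv01 s0' s1').
by rewrite !inE => /(_ Cx Cy); rewrite /conv/= /unstable.onem opprB addrCA subrr addr0.
Qed.

(** The map v |-> (v - (1 - s) a) / s preserves the affine hull and sends a
    neighbourhood of the combination into the given neighbourhood of b; its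
    inverse contracts C towards a, hence maps C into C. *)
Lemma rint_convex_comb (R : realType) (n : nat) (C : set 'rV[R]_n)
    (a b : 'rV[R]_n) (s : R) :
  convex_set C -> C a -> rint C b -> 0 < s <= 1 ->
  rint C ((1 - s) *: a + s *: b).
Proof.
move=> cC Ca [Cb [V Vb VC]] /andP[s0 s1].
have sN : s != 0 by rewrite gt_eqF.
split; first by apply: convex_set_comb => //; rewrite (ltW s0).
pose phi (v : 'rV[R]_n) : 'rV[R]_n := (1 - s^-1) *: a + s^-1 *: v.
exists (phi @^-1` V).
  have phic (p : 'rV[R]_n) : phi v @[v --> p] --> phi p.
    apply: (@cvgD R _ _ (nbhs p) _ (fun=> (1 - s^-1) *: a) (fun v => s^-1 *: v)).
      exact: cvg_cst.
    exact: (@cvgZl_tmp R _ _ (nbhs p) _ s^-1 id p).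
  apply: phic; suff -> : phi ((1 - s) *: a + s *: b) = b by [].
  rewrite /phi scalerDr !scalerA mulVf// scale1r addrA -scalerDl.
  by rewrite (_ : 1 - s^-1 + s^-1 * (1 - s) = 0) ?scale0r ?add0r//; field.
move=> v [/= Vv Av].
have Cphi : C (phi v).
  apply: VC; split; first exact: Vv.
  by move=> A [affA CA]; exact: affA (CA _ Ca) (Av A (conj affA CA)).
have -> : v = (1 - s) *: a + s *: phi v.
  rewrite /phi scalerDr !scalerA mulfV// scale1r addrA -scalerDl.
  by rewrite (_ : 1 - s + s * (1 - s^-1) = 0) ?scale0r ?add0r//; field.
by apply: convex_set_comb => //; rewrite (ltW s0).
Qed.

Lemma fine_ltyE (R : realType) (n : nat) (g : 'rV[R]_n -> \bar R) (x : 'rV[R]_n) :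
  (forall v, (-oo < g v)%E) -> (g x < +oo)%E -> g x = (fine (g x))%:E.
Proof. by move=> gN gx; rewrite fineK// fin_numElt gN gx. Qed.

Lemma econvex_fine (R : realType) (n : nat) (g : 'rV[R]_n -> \bar R)
    (a b : 'rV[R]_n) (s : R) :
  (forall v, (-oo < g v)%E) -> econvex g -> 0 < s < 1 ->
  (g a < +oo)%E -> (g b < +oo)%E ->
  (g ((1 - s) *: a + s *: b)%R < +oo)%E /\
  fine (g ((1 - s) *: a + s *: b)) <= (1 - s) * fine (g a) + s * fine (g b).
Proof.
move=> gN cg s01 ga gb; have := cg a b s s01.
rewrite (fine_ltyE gN ga) (fine_ltyE gN gb) -!EFinM -EFinD => H.
have gp := le_lt_trans H (ltry _); split=> //.
by move: H; rewrite (fine_ltyE gN gp) lee_fin.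
Qed.

(** Convexity bounds the difference quotients from x towards w by g w - g x. *)
Lemma econvex_gradient_le (R : realType) (n : nat) (g : 'rV[R]_n -> \bar R)
    (x w : 'rV[R]_n) :
  (forall v, (-oo < g v)%E) -> econvex g -> edifferentiable g x ->
  (g w < +oo)%E -> fine (g x) + dot (grad g x) (w - x) <= fine (g w).
Proof.
move=> gN cg [gx dg] gw; rewrite -lerBrDl.
have {}gx : (g x < +oo)%E by have := nbhs_singleton gx; rewrite ltey_eq => ->.
apply: dot_grad_le => // s s01.
have -> : x + s *: (w - x) = (1 - s) *: x + s *: w.
  by rewrite scalerBl scale1r scalerBr addrA addrAC.
have [_ H] := econvex_fine gN cg s01 gx gw.
lra.
Qed.

(** * Bregman distances and the three-point inequality *)

(** The value of [bregman] where both arguments lie in the domain: the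
    estimates below are linear inequalities between real numbers. *)
Definition rbregman (R : realType) (n : nat) (h : 'rV[R]_n -> \bar R)
    (x y : 'rV[R]_n) : R :=
  fine (h x) - fine (h y) - dot (grad h y) (x - y).

Lemma bregmanE (R : realType) (n : nat) (h : 'rV[R]_n -> \bar R)
    (x y : 'rV[R]_n) :
  (forall v, (-oo < h v)%E) -> (h x < +oo)%E -> (h y < +oo)%E ->
  bregman h x y = (rbregman h x y)%:E.
Proof.
by move=> hN hx hy; rewrite /bregman (fine_ltyE hN hx) (fine_ltyE hN hy) -!EFinB.
Qed.

Lemma edifferentiable_lty (R : realType) (n : nat) (g : 'rV[R]_n -> \bar R)
    (x : 'rV[R]_n) : edifferentiable g x -> (g x < +oo)%E.
Proof. by move=> [/nbhs_singleton gx _]; rewrite ltey_eq gx. Qed.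

(** Minimality of z is tested only at points of the segment from z to w: as they
    approach z, convexity of phi and differentiability of h at z give the
    variational inequality
      phi z - phi w <= c <grad h z - grad h zk, w - z>,
    and its right-hand side is the three-point combination of Bregman
    distances. *)
Lemma bregman_three_point (R : realType) (n : nat) (C : set 'rV[R]_n)
    (phi h : 'rV[R]_n -> \bar R) (c : R) (zk z w : 'rV[R]_n) :
  convex_set C -> (forall v, (-oo < phi v)%E) -> econvex phi ->
  (forall v, (-oo < h v)%E) -> econvex h ->
  edifferentiable h zk -> edifferentiable h z -> 0 < c ->
  argmin_on C (fun v => phi v + c%:E * bregman h v zk)%E z ->
  C w -> (phi w < +oo)%E -> (h w < +oo)%E ->
  (phi z < +oo)%E /\
  fine (phi z) + c * rbregman h z zk + c * rbregman h w z <=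
  fine (phi w) + c * rbregman h w zk.
Proof.
move=> cC phiN phic hN hc dzk dz c0 [Cz zmin] Cw phiw hw.
have hzk := edifferentiable_lty dzk.
have hz := edifferentiable_lty dz.
have phiz : (phi z < +oo)%E.
  have := zmin w Cw; rewrite !bregmanE// (fine_ltyE phiN phiw) -!EFinM -EFinD.
  by case: (phi z) => [r|//|//]; rewrite ?ltry.
split=> //.
have key : (fine (phi z) - fine (phi w)) / c + dot (grad h zk) (w - z) <=
           dot (grad h z) (w - z).
  apply: dot_grad_ge; first by case: dz.
  move=> s s01; pose zs := (1 - s) *: z + s *: w.
  have zsE : zs = z + s *: (w - z).
    by rewrite /zs scalerBl scale1r scalerBr addrA addrAC.
  have [phizs phics] := econvex_fine phiN phic s01 phiz phiw.
  have [hzs _] := econvex_fine hN hc s01 hz hw.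
  have Czs : C zs by apply: convex_set_comb => //; move/andP: s01 => [/ltW -> /ltW ->].
  have := zmin zs Czs; rewrite !bregmanE// (fine_ltyE phiN phiz) (fine_ltyE phiN phizs).
  rewrite -!EFinM -!EFinD lee_fin -zsE /rbregman => min_s.
  rewrite -(ler_pM2l c0) mulrCA mulrDr mulrCA mulfV ?gt_eqF// mulr1.
  rewrite mulrBr -/zs.
  have dzs : dot (grad h zk) (zs - zk) =
      dot (grad h zk) (z - zk) + s * dot (grad h zk) (w - z).
    by rewrite zsE -dotZr -dotDr addrAC.
  move: min_s phics; rewrite -/zs dzs; nra.
rewrite -(ler_pM2l c0) mulrDr mulrCA mulfV ?gt_eqF// mulr1 in key.
have -> : rbregman h w zk =
  fine (h w) - fine (h zk) - (dot (grad h zk) (w - z) + dot (grad h zk) (z - zk)).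
  by rewrite /rbregman -dotDr subrKA.
rewrite /rbregman; lra.
Qed.

Lemma rbregman_ge0 (R : realType) (n : nat) (h : 'rV[R]_n -> \bar R)
    (x y : 'rV[R]_n) :
  (forall v, (-oo < h v)%E) -> econvex h -> edifferentiable h y ->
  (h x < +oo)%E -> 0 <= rbregman h x y.
Proof.
move=> hN hc dy hx; have := econvex_gradient_le hN hc dy hx.
by rewrite /rbregman -addrA -opprD subr_ge0.
Qed.

Lemma linearization_econvex (R : realType) (n : nat)
    (f Psi : 'rV[R]_n -> \bar R) (y : 'rV[R]_n) :
  (forall v, (-oo < f v)%E) -> (f y < +oo)%E ->
  (forall v, (-oo < Psi v)%E) -> econvex Psi ->
  (forall v, (-oo < linearization f Psi v y)%E) /\
  econvex (fun v => linearization f Psi v y).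
Proof.
move=> fN fy PN Pc.
have linE v : linearization f Psi v y =
    ((fine (f y) + dot (grad f y) (v - y))%:E + Psi v)%E.
  by rewrite /linearization (fine_ltyE fN fy).
have linN v : (-oo < linearization f Psi v y)%E.
  by rewrite linE; move: (PN v); case: (Psi v) => [r|//|//]; rewrite ?ltNyr.
split=> // a b s s01; rewrite !linE !muleDr// addeACA; apply: leeD; last exact: Pc.
rewrite -!EFinM -EFinD lee_fin.
have -> : (1 - s) *: a + s *: b - y = (1 - s) *: (a - y) + s *: (b - y).
  by rewrite !scalerBr addrACA -opprD -scalerDl subrK scale1r.
by rewrite [dot _ (_ *: _ + _)]dotDr !dotZr; lra.
Qed.

(** * One iteration and the convergence rate *)

(** The hypothesis on Psi xk is conditional because Psi may be infinite at the
    starting point; there th = 1, and the term that contains it has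
    coefficient 0. *)
Lemma abpg_step (R : realType) (n : nat) (C : set 'rV[R]_n)
    (h f Psi : 'rV[R]_n -> \bar R) (L gamma g th : R)
    (xk zk z1 w : 'rV[R]_n) :
  let yk := (1 - th) *: xk + th *: zk in
  let x1 := (1 - th) *: xk + th *: z1 in
  convex_set C ->
  (forall v, (-oo < h v)%E) -> econvex h ->
  (forall v, (-oo < f v)%E) -> econvex f ->
  (forall v, (-oo < Psi v)%E) -> econvex Psi ->
  edifferentiable h zk -> edifferentiable h z1 -> edifferentiable f yk ->
  0 < g -> 0 < L -> 0 < th <= 1 ->
  argmin_on C (subproblem h f Psi L gamma g th yk zk) z1 ->
  accepted h f L gamma g th yk x1 z1 zk ->
  (f xk < +oo)%E -> (f x1 < +oo)%E -> (th < 1 -> (Psi xk < +oo)%E) ->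
  C w -> (h w < +oo)%E -> (f w < +oo)%E -> (Psi w < +oo)%E ->
  let Fr v := fine (f v) + fine (Psi v) in
  (Psi x1 < +oo)%E /\
  (Fr x1 - Fr w) + g * th `^ gamma * L * rbregman h w z1 <=
  (1 - th) * (Fr xk - Fr w) + g * th `^ gamma * L * rbregman h w zk.
Proof.
move=> yk x1 cC hN hc fN fc PN Pc dzk dz1 dfy g0 L0 /andP[th0 th1] amin acc
  fx fx1 Pxk Cw hw fw Pw Fr.
have fy := edifferentiable_lty dfy.
have hzk := edifferentiable_lty dzk.
have hz1 := edifferentiable_lty dz1.
have [lN lc] := linearization_econvex fN fy PN Pc.
have c0 : 0 < g * th `^ (gamma - 1) * L by rewrite !mulr_gt0// powR_gt0.
have cE : g * th `^ gamma * L = th * (g * th `^ (gamma - 1) * L).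
  have -> : th `^ gamma = th `^ (gamma - 1) * th.
    by rewrite powRB ?(gt_eqF th0) ?implybT// powRr1 ?ltW// divfK// gt_eqF.
  by ring.
have linE v : linearization f Psi v yk =
    ((fine (f yk) + dot (grad f yk) (v - yk))%:E + Psi v)%E.
  by rewrite /linearization (fine_ltyE fN fy).
have lw : (linearization f Psi w yk < +oo)%E.
  by rewrite linE (fine_ltyE PN Pw) -EFinD ltry.
(* Only the value at w is known to be finite; minimality transfers it to z1. *)
have [lz1 tp] := bregman_three_point cC lN lc hN hc dzk dz1 c0 amin Cw lw hw.
have Pz1 : (Psi z1 < +oo)%E.
  by move: lz1; rewrite linE; case: (Psi z1) => [r|//|//] _; rewrite ltry.
move: tp; rewrite !linE (fine_ltyE PN Pz1) (fine_ltyE PN Pw) -!EFinD /= => tp.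
move: acc; rewrite /accepted (fine_ltyE fN fx1) (fine_ltyE fN fy) bregmanE//.
rewrite -EFinM -!EFinD lee_fin cE => acc.
have grad_w := econvex_gradient_le fN fc dfy fw.
have grad_x := econvex_gradient_le fN fc dfy fx.
have x1y : dot (grad f yk) (x1 - yk) =
    (1 - th) * dot (grad f yk) (xk - yk) + th * dot (grad f yk) (z1 - yk).
  rewrite -!dotZr -dotDr; congr (dot _ _).
  by rewrite !scalerBr addrACA -opprD -scalerDl subrK scale1r.
have tp' := ler_wpM2l (ltW th0) tp.
have grad_w' := ler_wpM2l (ltW th0) grad_w.
have grad_x' : (1 - th) * (fine (f yk) + dot (grad f yk) (xk - yk)) <=
    (1 - th) * fine (f xk) by rewrite ler_wpM2l ?subr_ge0.
rewrite x1y in acc.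
have [Px1 Pconv] : (Psi x1 < +oo)%E /\
    fine (Psi x1) <= (1 - th) * fine (Psi xk) + th * fine (Psi z1).
  have [th_lt|th_ge] := ltP th 1.
    by apply: econvex_fine => //; rewrite ?th0//; exact: Pxk.
  rewrite /x1 (_ : th = 1); last by apply/eqP; rewrite eq_le th1.
  by rewrite subrr scale0r add0r scale1r mul0r add0r mul1r.
split=> //.
rewrite /Fr; lra.
Qed.

(* When F w = +oo the left-hand side is -oo (also if F (x k.+1) = +oo), so the
   inequality then holds trivially. *)
Theorem theorem3 (R : realType) (n : nat) (C : set 'rV[R]_n)
  (h f Psi F : 'rV[R]_n -> \bar R) (L gamma rho Gmin : R) (x0 : 'rV[R]_n)
  (x y z : nat -> 'rV[R]_n) (theta G : nat -> R) (t : nat -> nat)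
  (hSA : standing_assumption C h f Psi)
  (hF : F = (fun w => (f w + Psi w)%E))
  (hL : relatively_smooth C f h L)
  (hgamma : intrinsic_tse h gamma) (hgamma1 : 1 < gamma)
  (hx0 : rint C x0) (hrho : 1 < rho) (hGmin : 0 < Gmin)
  (hrun : abpg_g C h f Psi L gamma rho Gmin x0 x y z theta G t)
  (hwp : abpg_g_well_posed C h f Psi L gamma rho Gmin x z theta G t) :
  forall w : 'rV[R]_n, C w -> edom h w -> forall k : nat,
    (F (x k.+1) - F w <=
       ((gamma / (k%:R + gamma)) `^ gamma * Gbar gamma G k * L)%:E *
       bregman h w x0)%E.
Proof.
move=> w Cw hw k.
case: hSA => _ [cC] [[U [_ rU dU _]]] [[[hN _] hc _ _]].
case=> [[[fN _] _ fc [V [_ rV dV]]]] [[[PN _] _ Pc _] _].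
case: hL => L0 _.
case: hrun => ex0 [ez0 run].
have dh v : rint C v -> edifferentiable h v by move/rU/dU.
have df v : rint C v -> edifferentiable f v by move/rV/dV.
have G0 i : 0 < G i.
  have [-> _] := run i.
  by rewrite mulr_gt0 ?exprn_gt0 ?(lt_trans _ hrho)// lt_max hGmin orbT.
have th01 i : 0 < theta i <= 1.
  have [_ [+ _]] := run i.
  by rewrite /theta_rule; case: i => [->|i [//]]; rewrite ltr01 lexx.
have th_zero : theta 0%N = 1 by have [_ []] := run 0%N.
have th_rec i : (1 - theta i.+1) / (G i.+1 * theta i.+1 `^ gamma) =
    1 / (G i * theta i `^ gamma) by have [_ [[_ ]]] := run i.+1.
have rz i : rint C (z i).
  case: i => [|i]; first by rewrite ez0.
  have [EG [trule [Ey [zmin _]]]] := run i.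
  (* The kept iterate is the trial of index t i, whose minimizer is unique. *)
  have := hwp i (t i) (theta i) (leqnn _); rewrite /= -EG -Ey.
  by case/(_ trule) => z1 rz1 E; move: zmin; rewrite E => ->.
have rx i : rint C (x i).
  elim: i => [|i IH]; first by rewrite ex0.
  have [_ [_ [_ [_ [-> _]]]]] := run i.
  by apply: rint_convex_comb => //; case: IH.
have hx0' := edifferentiable_lty (dh _ hx0).
have gk0 : 0 <= (gamma / (k%:R + gamma)) `^ gamma * Gbar gamma G k.
  by rewrite mulr_ge0// powR_ge0.
rewrite bregmanE// hF.
have [fw|] := ltP (f w) +oo%E; last first.
  rewrite leye_eq => /eqP ->; rewrite addye ?gt_eqF ?PN//= addeNy.
  by rewrite leNye.
have [Pw|] := ltP (Psi w) +oo%E; last first.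
  rewrite leye_eq => /eqP ->; rewrite addey ?gt_eqF ?fN//= addeNy.
  by rewrite leNye.
pose Fr v := fine (f v) + fine (Psi v).
pose A i := G i * theta i `^ gamma.
have A0 i : 0 < A i by rewrite mulr_gt0// powR_gt0//; case/andP: (th01 i).
have step i : (theta i < 1 -> (Psi (x i) < +oo)%E) ->
    (Psi (x i.+1) < +oo)%E /\
    (Fr (x i.+1) - Fr w) + A i * L * rbregman h w (z i.+1) <=
    (1 - theta i) * (Fr (x i) - Fr w) + A i * L * rbregman h w (z i).
  move=> Px; have [_ [_ [Ey [zmin [Ex [acc _]]]]]] := run i.
  have ry : rint C (y i) by rewrite Ey; apply: rint_convex_comb => //; case: (rx i).
  rewrite Ex; apply: (@abpg_step R n C) => //.
  - exact: dh.
  - exact: dh.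
  - by rewrite -Ey; exact: df.
  - by rewrite -Ey.
  - by rewrite -Ex -Ey.
  - exact: edifferentiable_lty (df _ (rx i)).
  - by rewrite -Ex; exact: edifferentiable_lty (df _ (rx i.+1)).
have tele i : (Psi (x i.+1) < +oo)%E /\
    (Fr (x i.+1) - Fr w) / A i + L * rbregman h w (z i.+1) <=
    L * rbregman h w x0.
  elim: i => [|i [Px IH]].
    have [|Px1 H] := step 0%N; first by rewrite th_zero ltxx.
    split=> //; rewrite -(ler_pM2l (A0 0%N)) mulrDr mulrCA mulfV ?gt_eqF// mulr1.
    by move: H; rewrite th_zero subrr mul0r add0r ez0 !mulrA.
  have [//|Px1 H] := step i.+1; split=> //.
  apply: le_trans IH; rewrite -(ler_pM2l (A0 i.+1)).
  rewrite (mulrDr (A i.+1) (_ / A i.+1)) (mulrDr (A i.+1) (_ / A i)).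
  rewrite [A _ * (_ / A i.+1)]mulrCA mulfV ?gt_eqF// mulr1.
  have -> : A i.+1 * ((Fr (x i.+1) - Fr w) / A i) =
      (1 - theta i.+1) * (Fr (x i.+1) - Fr w).
    have -> : (A i)^-1 = (1 - theta i.+1) / A i.+1 by rewrite /A th_rec div1r.
    by rewrite mulrCA [A _ * _]mulrC divfK ?gt_eqF// mulrC.
  by rewrite !(mulrA (A i.+1)).
have [Px1 bound] := tele k.
have fx1 := edifferentiable_lty (df _ (rx k.+1)).
rewrite (fine_ltyE fN fx1) (fine_ltyE fN fw) (fine_ltyE PN Px1) (fine_ltyE PN Pw).
rewrite -!EFinD -EFinM lee_fin -/(Fr _) -/(Fr w).
have D0 := rbregman_ge0 hN hc (dh _ (rz k.+1)) hw.
have Dx0 := rbregman_ge0 hN hc (dh _ hx0) hw.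
have {}bound : Fr (x k.+1) - Fr w <= A k * (L * rbregman h w x0).
  rewrite mulrC -ler_pdivrMr//; apply: le_trans bound.
  by rewrite lerDl mulr_ge0// ltW.
apply: le_trans bound _; rewrite -[leRHS]mulrA ler_wpM2r ?mulr_ge0 ?(ltW L0)//.
exact: gain_product_bound.
Qed.
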